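(* Let $G$ and $G'$ be the knot groups of tame knots $K,K'\subset S^3$ ($K$ nontrivial) with meridians $m\in G$ and $m'\in G'$. Assume there is an isomorphism of topological groups $\Phi:\widehat G\xrightarrow{\ \cong\ }\widehat G'$ and an element $y\in\widehat G'$ with $$\Phi\big(\overline{\langle m\rangle}^{\,\widehat G}\big)=y\,\overline{\langle m'\rangle}^{\,\widehat G'}\,y^{-1}.$$ Then for every open subgroup $\widehat U\le\widehat G$, with $\widehat U':=\Phi(\widehat U)$, one has $$\Phi\big(\widehat M_{\widehat U}\big)=\widehat M_{\widehat U'} .$$ Moreover, $\Phi$ induces a canonical isomorphism of quotients $$\widehat U/\widehat M_{\widehat U}\ \cong\ \widehat U'/\widehat M_{\widehat U'} .$$
   Context: For a tame knot $K\subset S^3$ with tubular neighbourhood $\nu(K)$, let $X_K=S^3\setminus\operatorname{int}(\nu(K))$ be the knot exterior, $x_0\in\partial X_K$ a basepoint, and $G=\pi_1(X_K,x_0)$ the knot group. A meridian is an element of $\pi_1(\partial X_K,x_0)$ represented by a simple closed curve on the torus $\partial X_K$ bounding an embedded disk in $\nu(K)$ that meets $K$ once; $m\in G$ denotes the image of a chosen meridian in $G$. The same notation with primes is used for $K'$. $\widehat G$ is the profinite completion of $G$, with $G$ viewed as a dense subgroup, and $\overline{\langle m\rangle}^{\,\widehat G}$ is the closure of $\langle m\rangle$ in $\widehat G$. For an open subgroup $\widehat U\le\widehat G$ and $x\in\widehat G$, the closed inertia subgroup is $\widehat I_x(\widehat U):=\widehat U\cap x\,\overline{\langle m\rangle}^{\,\widehat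 G}\,x^{-1}$, and the closed ramification subgroup $\widehat M_{\widehat U}$ is the smallest closed normal subgroup of $\widehat U$ containing $\widehat I_x(\widehat U)$ for all $x\in\widehat G$. For open subgroups $\widehat U'\le\widehat G'$ the subgroups $\widehat I_{x'}(\widehat U')$ ($x'\in\widehat G'$) and $\widehat M_{\widehat U'}$ are defined in the same way using $m'$ and $\widehat G'$. *)

(* Defs.v *)
From HB Require Import structures.
From mathcomp Require Import all_boot all_order all_algebra generic_quotient.
From mathcomp Require Import all_classical all_reals all_analysis homotopy.
From mathcomp Require Import ring lra.

Set Implicit Arguments.
Unset Strict Implicit.
Unset Printing Implicit Defensive.

Import Order.TTheory GRing.Theory Num.Theory.
Import numFieldNormedType.Exports.

Local Open Scope classical_set_scope.
Local Open Scope ring_scope.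
Local Open Scope quotient_scope.

Lemma pair_cts (S A B : topologicalType) (f : S -> A) (g : S -> B) :
  continuous f -> continuous g -> continuous (fun s => (f s, g s)).
Proof. by move=> cf cg s; exact: (cvg_pair (cf s) (cg s)). Qed.

Lemma comp_cts (S A B : topologicalType) (f : S -> A) (g : A -> B) :
  continuous f -> continuous g -> continuous (fun s => g (f s)).
Proof. by move=> cf cg s; apply: continuous_comp; [exact: cf|exact: cg]. Qed.

Lemma fst_cts (A B : topologicalType) : continuous (fun x : A * B => x.1).
Proof. by move=> x; exact: cvg_fst. Qed.

Lemma snd_cts (A B : topologicalType) : continuous (fun x : A * B => x.2).
Proof. by move=> x; exact: cvg_snd. Qed.

Section UnitInterval.
Variable R : realType.

Definition unit_interval : Type := set_type `[(0 : R), 1]%classic.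

HB.instance Definition _ :=
  Topological.copy unit_interval (set_type `[(0 : R), 1]%classic).

Lemma mem_unit0 : (0 : R) \in `[(0 : R), 1]%classic.
Proof. by rewrite inE /= in_itv /= lexx ler01. Qed.
Lemma mem_unit1 : (1 : R) \in `[(0 : R), 1]%classic.
Proof. by rewrite inE /= in_itv /= lexx ler01. Qed.

Definition unit0 : unit_interval := exist _ 0 mem_unit0.
Definition unit1 : unit_interval := exist _ 1 mem_unit1.

Lemma unit0_neq1 : unit0 != unit1.
Proof. by apply/eqP => /(congr1 val)/= /eqP; rewrite eq_sym oner_eq0. Qed.

HB.instance Definition _ := isBiPointed.Build unit_interval unit0_neq1.

Definition clamp01 (t : R) : R := Num.max 0 (Num.min t 1).

Lemma clamp01_mem t : clamp01 t \in `[(0 : R), 1]%classic.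
Proof.
rewrite inE /= in_itv /= /clamp01 le_max lexx /= ge_max ler01 /=.
by rewrite ge_min lexx orbT.
Qed.

Definition clamp (t : R) : unit_interval := exist _ (clamp01 t) (clamp01_mem t).

Definition uval (t : unit_interval) : R := \val t.

Lemma uval_cts : continuous uval.
Proof. exact: initial_continuous. Qed.

Lemma clamp_cts : continuous clamp.
Proof.
apply: continuous_comp_initial => t.
apply: (@continuous_max R R (cst 0) (fun t : R => Num.min t 1)).
  exact: cvg_cst.
apply: (@continuous_min R R id (cst 1)); first exact: cvg_id.
exact: cst_continuous.
Qed.

Lemma uval_ge0 (t : unit_interval) : 0 <= uval t.
Proof. by case: t => t /=; rewrite /uval /= inE /= in_itv /= => /andP[]. Qed.
Lemma uval_le1 (t : unit_interval) : uval t <= 1.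
Proof. by case: t => t /=; rewrite /uval /= inE /= in_itv /= => /andP[]. Qed.

Lemma uvalK : cancel uval clamp.
Proof.
move=> t; apply: val_inj => /=; rewrite /clamp01 -/(uval t).
by rewrite min_l ?uval_le1// max_r ?uval_ge0.
Qed.

Lemma clamp_le0 t : t <= 0 -> clamp t = zero.
Proof.
move=> t0; apply: val_inj => /=; rewrite /clamp01 min_l ?max_l//.
by rewrite (le_trans t0).
Qed.

Lemma clamp_ge1 t : 1 <= t -> clamp t = one.
Proof. by move=> t1; apply: val_inj => /=; rewrite /clamp01 min_r ?max_r. Qed.

End UnitInterval.

Section Homotopy.
Variables (R : realType) (T : topologicalType) (x : T).
Local Notation I := (unit_interval R).
Local Notation loop := {path I from x to x in T}.

(* Homotopy relative to the endpoints; H (t, s) is the path at time s. *)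
Definition path_homotopic (p q : loop) : Prop :=
  exists H : I * I -> T,
    [/\ continuous H,
        forall t, H (t, zero) = p t,
        forall t, H (t, one) = q t,
        forall s, H (zero, s) = x &
        forall s, H (one, s) = x].

(* A loop extended to the whole line by the constant x outside [0, 1]. *)
Definition ext (p : loop) (t : R) : T := p (clamp t).

Arguments ext : simpl never.

Lemma ext_cts p : continuous (ext p).
Proof. by move=> t; apply: continuous_comp; [exact: clamp_cts|exact: cts_fun]. Qed.

Lemma ext_le0 p t : t <= 0 -> ext p t = x.
Proof. by move=> t0; rewrite /ext clamp_le0// path_zero. Qed.
Lemma ext_ge1 p t : 1 <= t -> ext p t = x.
Proof. by move=> t0; rewrite /ext clamp_ge1// path_one. Qed.
Lemma ext_uval p t : ext p (uval t) = p t.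
Proof. by rewrite /ext uvalK. Qed.

Lemma path_homotopicP (p q : loop) :
  path_homotopic p q <->
  exists K : R * R -> T,
    [/\ continuous K,
        forall t s, s <= 0 -> K (t, s) = ext p t,
        forall t s, 1 <= s -> K (t, s) = ext q t,
        forall t s, t <= 0 -> K (t, s) = x &
        forall t s, 1 <= t -> K (t, s) = x].
Proof.
split=> [[H [cH H0 H1 Hl Hr]]|[K [cK K0 K1 Kl Kr]]].
  exists (fun ts => H (clamp ts.1, clamp ts.2)); split=> /=.
  - apply: (comp_cts _ cH); apply: pair_cts.
      exact: (comp_cts (@fst_cts _ _) (@clamp_cts R)).
    exact: (comp_cts (@snd_cts _ _) (@clamp_cts R)).
  - by move=> t s s0; rewrite (clamp_le0 s0) H0.
  - by move=> t s s0; rewrite (clamp_ge1 s0) H1.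
  - by move=> t s s0; rewrite (clamp_le0 s0) Hl.
  - by move=> t s s0; rewrite (clamp_ge1 s0) Hr.
exists (fun ts => K (uval ts.1, uval ts.2)); split=> /=.
- apply: (comp_cts _ cK); apply: pair_cts.
  exact: (comp_cts (@fst_cts _ _) (@uval_cts R)).
  exact: (comp_cts (@snd_cts _ _) (@uval_cts R)).
- by move=> t; rewrite K0 ?lexx// ext_uval.
- by move=> t; rewrite K1 ?lexx// ext_uval.
- by move=> s; rewrite Kl ?lexx.
- by move=> s; rewrite Kr ?lexx.
Qed.

Lemma glue_cts (S : topologicalType) (h : S -> R) (f g : S -> T) :
  continuous h -> continuous f -> continuous g ->
  (forall s, h s = 0 -> f s = g s) ->
  continuous (fun s => if h s <= 0 then f s else g s).
Proof.
move=> ch cf cg fg.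
have cA : closed [set s | h s <= 0].
  apply: (@closed_comp _ _ h [set r | r <= 0]); last exact: closed_le.
  by move=> s _; exact: ch.
have cB : closed [set s | 0 <= h s].
  apply: (@closed_comp _ _ h [set r | 0 <= r]); last exact: closed_ge.
  by move=> s _; exact: ch.
apply/continuous_subspace_setT.
have -> : [set: S] = [set s | h s <= 0] `|` [set s | 0 <= h s].
  by apply/seteqP; split=> // s _ /=; case: (leP (h s) 0) => ?; [left|right; exact: ltW].
apply: withinU_continuous => //.
- apply: (@subspace_eq_continuous _ _ _ f); last exact: continuous_subspaceT.
  by move=> s; rewrite inE /from_subspace /= => ->.
- apply: (@subspace_eq_continuous _ _ _ g); last exact: continuous_subspaceT.
  move=> s; rewrite inE /from_subspace /= => h0; case: ifPn => // h1.
  by rewrite -fg//; apply/eqP; rewrite eq_le h0 h1.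
Qed.

Lemma homotopic_refl p : path_homotopic p p.
Proof.
apply/path_homotopicP; exists (fun ts => ext p ts.1); split => /=.
- exact: (comp_cts (@fst_cts _ _) (@ext_cts p)).
- by [].
- by [].
- by move=> t s /ext_le0.
- by move=> t s /ext_ge1.
Qed.

Lemma homotopic_sym p q : path_homotopic p q -> path_homotopic q p.
Proof.
move=> /path_homotopicP[K [cK K0 K1 Kl Kr]]; apply/path_homotopicP.
exists (fun ts => K (ts.1, 1 - ts.2)); split => /=.
- apply: (comp_cts _ cK); apply: pair_cts; first exact: fst_cts.
  move=> y; apply: cvgB; [exact: cvg_cst|exact: snd_cts].
- by move=> t s s0; rewrite K1//; lra.
- by move=> t s s0; rewrite K0//; lra.
- by move=> t s s0; rewrite Kl.
- by move=> t s s0; rewrite Kr.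
Qed.

Lemma affine_cts (S : topologicalType) (f : S -> R) (a b : R) :
  continuous f -> continuous (fun s => a * f s + b).
Proof.
move=> cf s; apply: cvgD; last exact: cvg_cst.
by apply: cvgM; [exact: cvg_cst|exact: cf].
Qed.

Lemma oneB_cts (S : topologicalType) (f : S -> R) :
  continuous f -> continuous (fun s => 1 - f s).
Proof. by move=> cf s; apply: cvgB; [exact: cvg_cst|exact: cf]. Qed.

Lemma min_cts (S : topologicalType) (f g : S -> R) :
  continuous f -> continuous g -> continuous (fun s => Num.min (f s) (g s)).
Proof.
by move=> cf cg s; apply: (@continuous_min R S f g); [exact: cf|exact: cg].
Qed.

Lemma homotopic_trans p q r :
  path_homotopic p q -> path_homotopic q r -> path_homotopic p r.
Proof.
move=> /path_homotopicP[K [cK K0 K1 Kl Kr]] /path_homotopicP[L [cL L0 L1 Ll Lr]].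
apply/path_homotopicP.
exists (fun ts => if 2 * ts.2 + -1 <= 0 then K (ts.1, 2 * ts.2 + 0)
                  else L (ts.1, 2 * ts.2 + -1)); split => /=.
- apply: glue_cts.
  + exact/affine_cts/snd_cts.
  + apply: (comp_cts _ cK); apply: pair_cts; first exact: fst_cts.
    exact/affine_cts/snd_cts.
  + apply: (comp_cts _ cL); apply: pair_cts; first exact: fst_cts.
    exact/affine_cts/snd_cts.
  + move=> [t s] /= s0; rewrite K1 ?L0//; lra.
- by move=> t s s0; rewrite ifT ?K0//; lra.
- by move=> t s s0; rewrite ifF ?L1//; [lra|apply/negP; lra].
- by move=> t s s0; case: ifPn => _; rewrite ?Kl ?Ll.
- by move=> t s s0; case: ifPn => _; rewrite ?Kr ?Lr.
Qed.

Definition concat_fun (p q : loop) (t : I) : T :=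
  if 2 * uval t - 1 <= 0 then ext p (2 * uval t) else ext q (2 * uval t - 1).

Lemma concat_cts p q : continuous (concat_fun p q).
Proof.
have c2 : continuous (fun t : I => 2 * uval t : R).
  have -> : (fun t : I => 2 * uval t : R) = (fun t => 2 * uval t + 0).
    by apply/funext => t; rewrite addr0.
  exact/affine_cts/uval_cts.
have c3 : continuous (fun t : I => 2 * uval t - 1 : R).
  exact/affine_cts/uval_cts.
apply: glue_cts => //.
- exact: (comp_cts c2 (@ext_cts p)).
- exact: (comp_cts c3 (@ext_cts q)).
- by move=> t t0; rewrite ext_ge1 ?ext_le0//; lra.
Qed.

Lemma concat0 p q : concat_fun p q zero = x.
Proof.
rewrite /concat_fun; have -> : uval (zero : I) = 0 by [].
by rewrite ifT ?ext_le0//; lra.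
Qed.

Lemma concat1 p q : concat_fun p q one = x.
Proof.
rewrite /concat_fun; have -> : uval (one : I) = 1 by [].
by rewrite ifF ?ext_ge1//; [lra|apply/negP; lra].
Qed.

Definition concat (p q : loop) : loop :=
  mk_path (@concat_cts p q) (concat0 p q) (concat1 p q).

Definition reverse_fun (p : loop) (t : I) : T := p (clamp (1 - uval t)).

Lemma reverse_cts p : continuous (reverse_fun p).
Proof.
have c1 : continuous (fun t : I => 1 - uval t : R).
  exact/oneB_cts/uval_cts.
exact: (comp_cts c1 (@ext_cts p)).
Qed.

Lemma reverse0 p : reverse_fun p zero = x.
Proof. by rewrite /reverse_fun subr0 clamp_ge1// path_one. Qed.

Lemma reverse1 p : reverse_fun p one = x.
Proof. by rewrite /reverse_fun subrr clamp_le0// path_zero. Qed.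

Definition reverse (p : loop) : loop :=
  mk_path (@reverse_cts p) (reverse0 p) (reverse1 p).

Definition const_loop : loop := cst x.

Lemma ext_concat p q t :
  ext (concat p q) t =
  if 2 * t - 1 <= 0 then ext p (2 * t) else ext q (2 * t - 1).
Proof.
rewrite {1}/ext /= /mk_path /concat_fun; case: (leP t 0) => [t0|t0].
  have -> : uval (clamp t) = 0 by rewrite clamp_le0.
  rewrite ifT; last lra; rewrite ifT; last lra.
  by rewrite !ext_le0//; lra.
case: (leP 1 t) => [t1|t1].
  have -> : uval (clamp t) = 1 by rewrite clamp_ge1.
  rewrite ifF; last (apply/negP; lra); rewrite ifF; last (apply/negP; lra).
  by rewrite !ext_ge1//; lra.
suff -> : uval (clamp t) = t by [].
by rewrite /uval /= /clamp01 min_l ?max_r//; exact: ltW.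
Qed.

Lemma ext_reverse p t : ext (reverse p) t = ext p (1 - t).
Proof.
rewrite {1}/ext /= /mk_path /reverse_fun; case: (leP t 0) => [t0|t0].
  have -> : uval (clamp t) = 0 by rewrite clamp_le0.
  by rewrite -/(ext _ _) !ext_ge1//; lra.
case: (leP 1 t) => [t1|t1].
  have -> : uval (clamp t) = 1 by rewrite clamp_ge1.
  by rewrite -/(ext _ _) !ext_le0//; lra.
suff -> : uval (clamp t) = t by [].
by rewrite /uval /= /clamp01 min_l ?max_r//; exact: ltW.
Qed.

Lemma concat_homotopic p p' q q' : path_homotopic p p' -> path_homotopic q q' ->
  path_homotopic (concat p q) (concat p' q').
Proof.
move=> /path_homotopicP[K [cK K0 K1 Kl Kr]] /path_homotopicP[L [cL L0 L1 Ll Lr]].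
apply/path_homotopicP.
exists (fun ts => if 2 * ts.1 + -1 <= 0 then K (2 * ts.1 + 0, ts.2)
                  else L (2 * ts.1 + -1, ts.2)); split => /=.
- apply: glue_cts.
  + exact/affine_cts/fst_cts.
  + apply: (comp_cts _ cK); apply: pair_cts; last exact: snd_cts.
    exact/affine_cts/fst_cts.
  + apply: (comp_cts _ cL); apply: pair_cts; last exact: snd_cts.
    exact/affine_cts/fst_cts.
  + by move=> [t s] /= s0; rewrite Kr ?Ll//; lra.
- by move=> t s s0; rewrite ext_concat K0// L0// addr0.
- by move=> t s s0; rewrite ext_concat K1// L1// addr0.
- by move=> t s s0; case: ifPn => _; rewrite ?Kl ?Ll//; lra.
- by move=> t s s0; case: ifPn => _; rewrite ?Kr ?Lr//; lra.
Qed.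

Lemma reverse_homotopic p p' : path_homotopic p p' ->
  path_homotopic (reverse p) (reverse p').
Proof.
move=> /path_homotopicP[K [cK K0 K1 Kl Kr]]; apply/path_homotopicP.
exists (fun ts => K (1 - ts.1, ts.2)); split => /=.
- apply: (comp_cts _ cK); apply: pair_cts; last exact: snd_cts.
  exact/oneB_cts/fst_cts.
- by move=> t s s0; rewrite ext_reverse K0.
- by move=> t s s0; rewrite ext_reverse K1.
- by move=> t s s0; rewrite Kr//; lra.
- by move=> t s s0; rewrite Kl//; lra.
Qed.

Lemma homotopic_ext p q : ext p =1 ext q -> path_homotopic p q.
Proof.
move=> pq; suff -> : p = q by exact: homotopic_refl.
by apply/path_eqP => t; rewrite -!ext_uval pq.
Qed.

Lemma homotopic_reparam p q (f : R -> R) :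
  continuous f -> (forall t, t <= 0 -> f t <= 0) -> (forall t, 1 <= t -> 1 <= f t) ->
  (forall t, ext q t = ext p (f t)) -> path_homotopic p q.
Proof.
move=> cf f0 f1 qE; apply/path_homotopicP.
pose c (s : R) : R := clamp01 s.
have cc : continuous c.
  exact: (comp_cts (@clamp_cts R) (@uval_cts R)).
exists (fun ts => ext p ((1 - c ts.2) * ts.1 + c ts.2 * f ts.1)); split => /=.
- apply: (comp_cts _ (@ext_cts p)) => y.
  have c2 : continuous (fun ts : R * R => c ts.2) := comp_cts (@snd_cts _ _) cc.
  apply: cvgD; apply: cvgM.
  + exact: (oneB_cts c2).
  + exact: fst_cts.
  + exact: c2.
  + exact: (comp_cts (@fst_cts _ _) cf).
- move=> t s s0; have -> : c s = 0.
    by have := congr1 (@uval R) (clamp_le0 s0).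
  by rewrite subr0 mul1r mul0r addr0.
- move=> t s s0; have -> : c s = 1.
    by have := congr1 (@uval R) (clamp_ge1 s0).
  by rewrite subrr mul1r mul0r add0r qE.
- move=> t s t0; have c0 : 0 <= c s := uval_ge0 (clamp s).
  have c1 : c s <= 1 := uval_le1 (clamp s).
  by rewrite ext_le0//; have := f0 _ t0; nra.
- move=> t s t0; have c0 : 0 <= c s := uval_ge0 (clamp s).
  have c1 : c s <= 1 := uval_le1 (clamp s).
  by rewrite ext_ge1//; have := f1 _ t0; nra.
Qed.

Lemma ext_const t : ext const_loop t = x. Proof. by []. Qed.

Lemma concat_const_l p : path_homotopic (concat const_loop p) p.
Proof.
apply: homotopic_sym; apply: (@homotopic_reparam _ _ (fun t => 2 * t + -1)).
- by apply: affine_cts => t; exact: cvg_id.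
- by move=> t; lra.
- by move=> t; lra.
- move=> t; rewrite ext_concat; case: ifPn => // t0.
  by rewrite ext_const ext_le0.
Qed.

Lemma concat_const_r p : path_homotopic (concat p const_loop) p.
Proof.
apply: homotopic_sym; apply: (@homotopic_reparam _ _ (fun t => 2 * t + 0)).
- by apply: affine_cts => t; exact: cvg_id.
- by move=> t; lra.
- by move=> t; lra.
- move=> t; rewrite ext_concat addr0; case: ifPn => // t0.
  by rewrite ext_const ext_ge1//; lra.
Qed.

Lemma concatA p q r :
  path_homotopic (concat p (concat q r)) (concat (concat p q) r).
Proof.
apply: (@homotopic_reparam _ _
  (fun t => Num.min (2 * t + 0) (Num.min (1 * t + 4^-1) (2^-1 * t + 2^-1)))).
- have ac a b : continuous (fun t : R => a * t + b).
    by apply: affine_cts => u; exact: cvg_id.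
  by apply: min_cts => //; exact: min_cts.
- by move=> t t0; rewrite ge_min; apply/orP; left; lra.
- by move=> t t1; rewrite !le_min; apply/and3P; split; lra.
- move=> t; rewrite !ext_concat; case: ifPn => t1.
    have -> : Num.min (1 * t + 4^-1) (2^-1 * t + 2^-1) = 1 * t + 4^-1.
      by rewrite min_l//; lra.
    case: ifPn => t2.
      have -> : Num.min (2 * t + 0) (1 * t + 4^-1) = 2 * t + 0.
        by rewrite min_l//; lra.
      by rewrite ifT//; [congr ext; lra|lra].
    have -> : Num.min (2 * t + 0) (1 * t + 4^-1) = 1 * t + 4^-1.
      by rewrite min_r//; lra.
    rewrite ifF; last by apply/negP; lra.
    by rewrite ifT; [congr ext; lra|lra].
  have -> : Num.min (1 * t + 4^-1) (2^-1 * t + 2^-1) = 2^-1 * t + 2^-1.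
    by rewrite min_r//; lra.
  have -> : Num.min (2 * t + 0) (2^-1 * t + 2^-1) = 2^-1 * t + 2^-1.
    by rewrite min_r//; lra.
  rewrite ifF; last by apply/negP; lra.
  by rewrite ifF; [congr ext; lra|apply/negP; lra].
Qed.

Lemma concat_reverse_r p : path_homotopic (concat p (reverse p)) const_loop.
Proof.
apply/path_homotopicP; pose f (t : R) : R := 1 - `|2 * t + -1|.
have cf : continuous f.
  apply: oneB_cts => t; apply: cvg_norm.
  by apply: affine_cts => u; exact: cvg_id.
have fE t : ext (concat p (reverse p)) t = ext p (f t).
  rewrite ext_concat ext_reverse /f; case: ifPn => t0.
    by rewrite ler0_norm//; congr ext; lra.
  by rewrite gtr0_norm; [congr ext; lra|lra].
have f0 t : t <= 0 -> f t <= 0 by rewrite /f => t0; rewrite ler0_norm; lra.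
have f1 t : 1 <= t -> f t <= 0 by rewrite /f => t0; rewrite ger0_norm; lra.
pose c (s : R) : R := clamp01 s.
have cc : continuous c := comp_cts (@clamp_cts R) (@uval_cts R).
have ctp s t : f t <= 0 -> (1 - c s) * f t <= 0.
  have c1 : c s <= 1 := uval_le1 (clamp s).
  nra.
exists (fun ts => ext p ((1 - c ts.2) * f ts.1)); split => /=.
- apply: (comp_cts _ (@ext_cts p)) => y; apply: cvgM.
    exact: (oneB_cts (comp_cts (@snd_cts _ _) cc)).
  exact: (comp_cts (@fst_cts _ _) cf).
- move=> t s s0; have -> : c s = 0 by have := congr1 (@uval R) (clamp_le0 s0).
  by rewrite subr0 mul1r fE.
- move=> t s s0; have -> : c s = 1 by have := congr1 (@uval R) (clamp_ge1 s0).
  by rewrite subrr mul0r ext_le0.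
- by move=> t s t0; rewrite ext_le0//; exact/ctp/f0.
- by move=> t s t0; rewrite ext_le0//; exact/ctp/f1.
Qed.

Lemma reverseK p : reverse (reverse p) = p.
Proof.
apply/path_eqP => t; rewrite -!ext_uval !ext_reverse; congr ext; lra.
Qed.

Lemma concat_reverse_l p : path_homotopic (concat (reverse p) p) const_loop.
Proof. by rewrite -{2}(reverseK p); exact: concat_reverse_r. Qed.

End Homotopy.

Section FundamentalGroup.
Variables (R : realType) (T : topologicalType) (x : T).
Local Notation loop := {path (unit_interval R) from x to x in T}.

Let homot (p q : loop) : bool := `[< path_homotopic p q >].

Let homot_refl : reflexive homot.
Proof. by move=> p; apply/asboolP; exact: homotopic_refl. Qed.
Let homot_sym : symmetric homot.
Proof. by move=> p q; apply/asboolP/asboolP; exact: homotopic_sym. Qed.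
Let homot_trans : transitive homot.
Proof.
move=> q p r /asboolP pq /asboolP qr.
by apply/asboolP; exact: homotopic_trans pq qr.
Qed.

Definition homotopy_equiv : equiv_rel loop :=
  EquivRel homot homot_refl homot_sym homot_trans.

Definition pi1 : Type := {eq_quot homotopy_equiv}.

HB.instance Definition _ := Choice.copy pi1 {eq_quot homotopy_equiv}.
HB.instance Definition _ := Quotient.copy pi1 {eq_quot homotopy_equiv}.

Definition loop_class (p : loop) : pi1 := \pi_({eq_quot homotopy_equiv}) p.

Lemma loop_classP p q : loop_class p = loop_class q <-> path_homotopic p q.
Proof. by split=> [/eqmodP/asboolP//|h]; apply/eqmodP/asboolP. Qed.

Lemma loop_classK (a : pi1) : loop_class (repr a) = a.
Proof. exact: (@reprK _ {eq_quot homotopy_equiv}). Qed.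

Definition pi1_mul (a b : pi1) : pi1 := loop_class (concat (repr a) (repr b)).
Definition pi1_inv (a : pi1) : pi1 := loop_class (reverse (repr a)).
Definition pi1_one : pi1 := loop_class (const_loop R x).

Lemma pi1_mulE p q : pi1_mul (loop_class p) (loop_class q) = loop_class (concat p q).
Proof.
by apply/loop_classP/concat_homotopic; apply/loop_classP; rewrite loop_classK.
Qed.

Lemma pi1_invE p : pi1_inv (loop_class p) = loop_class (reverse p).
Proof. by apply/loop_classP/reverse_homotopic/loop_classP; rewrite loop_classK. Qed.

Fact pi1_mulA : associative pi1_mul.
Proof.
move=> a b c; rewrite -(loop_classK a) -(loop_classK b) -(loop_classK c) !pi1_mulE.
exact/loop_classP/concatA.
Qed.
Fact pi1_mul1g : left_id pi1_one pi1_mul.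
Proof.
by move=> a; rewrite -(loop_classK a) pi1_mulE; exact/loop_classP/concat_const_l.
Qed.
Fact pi1_mulg1 : right_id pi1_one pi1_mul.
Proof.
by move=> a; rewrite -(loop_classK a) pi1_mulE; exact/loop_classP/concat_const_r.
Qed.
Fact pi1_mulVg : left_inverse pi1_one pi1_inv pi1_mul.
Proof.
move=> a; rewrite -(loop_classK a) pi1_invE pi1_mulE.
exact/loop_classP/concat_reverse_l.
Qed.
Fact pi1_mulgV : right_inverse pi1_one pi1_inv pi1_mul.
Proof.
move=> a; rewrite -(loop_classK a) pi1_invE pi1_mulE.
exact/loop_classP/concat_reverse_r.
Qed.

HB.instance Definition _ :=
  isGroup.Build pi1 pi1_mulA pi1_mul1g pi1_mulg1 pi1_mulVg pi1_mulgV.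

End FundamentalGroup.

Section InducedMap.
Variables (R : realType) (S T : topologicalType) (f : continuousType S T) (x : S).

Definition pi1_map (a : pi1 R x) : pi1 R (f x) := loop_class (f \o repr a).

Lemma pi1_mapE (p : {path (unit_interval R) from x to x in S}) :
  pi1_map (loop_class p) = loop_class (f \o p).
Proof.
apply/loop_classP.
have /loop_classP[H [cH H0 H1 Hl Hr]] := loop_classK (loop_class p).
exists (f \o H); split=> //=.
- exact: (comp_cts cH (@cts_fun _ _ f)).
- by move=> t; rewrite H0.
- by move=> t; rewrite H1.
- by move=> t; rewrite Hl.
- by move=> t; rewrite Hr.
Qed.

End InducedMap.

Section Subgroups.
Variable G : groupType.

Definition is_subgroup (H : set G) : Prop :=
  H 1%g /\ forall x y, H x -> H y -> H (x / y)%g.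

Definition is_normal (N : set G) : Prop := forall x g, N x -> N (x ^ g)%g.

Record normalSubgroup := NormalSubgroup {
  nsg_set :> set G;
  nsg_subgroup : is_subgroup nsg_set;
  nsg_normal : is_normal nsg_set }.

Definition cyclic_subgroup (m : G) : set G :=
  [set x | exists n : nat, (x = m ^+ n \/ x = m ^- n)%g].

Definition conj_set (A : set G) (x : G) : set G :=
  [set (x * a * x^-1)%g | a in A].

Lemma subgroupV (H : set G) x : is_subgroup H -> H x -> H x^-1%g.
Proof. by move=> [H1 HD] Hx; rewrite -div1g; exact: HD. Qed.

Lemma subgroupM (H : set G) x y : is_subgroup H -> H x -> H y -> H (x * y)%g.
Proof.
by move=> sH Hx Hy; rewrite -(invgK y); apply: sH.2 => //; exact: subgroupV.
Qed.

End Subgroups.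

Section Quotient.
Variables (G : groupType) (N : normalSubgroup G).

Let coset (x y : G) : bool := `[< nsg_set N (x^-1 * y)%g >].

Let coset_refl : reflexive coset.
Proof. by move=> x; apply/asboolP; rewrite mulVg; exact: (nsg_subgroup N).1. Qed.
Let coset_sym : symmetric coset.
Proof.
have cs x y : nsg_set N (x^-1 * y)%g -> nsg_set N (y^-1 * x)%g.
  by move=> /(subgroupV (nsg_subgroup N)); rewrite invgM invgK.
by move=> x y; apply/asboolP/asboolP; exact: cs.
Qed.
Let coset_trans : transitive coset.
Proof.
move=> y x z /asboolP xy /asboolP yz; apply/asboolP.
have := subgroupM (nsg_subgroup N) xy yz.
by rewrite -mulgA (mulgA y) mulgV mul1g.
Qed.

Definition coset_equiv : equiv_rel G := EquivRel coset coset_refl coset_sym coset_trans.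

Definition quotient : Type := {eq_quot coset_equiv}.

HB.instance Definition _ := Choice.copy quotient {eq_quot coset_equiv}.
HB.instance Definition _ := Quotient.copy quotient {eq_quot coset_equiv}.

Definition coset_of (x : G) : quotient := \pi_({eq_quot coset_equiv}) x.

Lemma coset_ofP x y : coset_of x = coset_of y <-> nsg_set N (x^-1 * y)%g.
Proof. by split=> [/eqmodP/asboolP//|h]; apply/eqmodP/asboolP. Qed.

Lemma coset_ofK (a : quotient) : coset_of (repr a) = a.
Proof. exact: (@reprK _ {eq_quot coset_equiv}). Qed.

Definition quotient_mul (a b : quotient) := coset_of (repr a * repr b)%g.
Definition quotient_inv (a : quotient) := coset_of (repr a)^-1%g.

Lemma quotient_mulE x y :
  quotient_mul (coset_of x) (coset_of y) = coset_of (x * y)%g.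
Proof.
apply/coset_ofP; set x' := repr _; set y' := repr _.
have xx : nsg_set N (x'^-1 * x)%g by apply/coset_ofP; rewrite coset_ofK.
have yy : nsg_set N (y'^-1 * y)%g by apply/coset_ofP; rewrite coset_ofK.
have -> : ((x' * y')^-1 * (x * y) = ((x'^-1 * x) ^ y') * (y'^-1 * y))%g.
  by rewrite /conjg invgM !mulgA mulgK.
by apply: subgroupM => //; [exact: nsg_subgroup|exact: nsg_normal].
Qed.

Lemma quotient_invE x : quotient_inv (coset_of x) = coset_of x^-1%g.
Proof.
apply/coset_ofP; set x' := repr _; rewrite invgK.
have xx : nsg_set N (x'^-1 * x)%g by apply/coset_ofP; rewrite coset_ofK.
have -> : (x' * x^-1 = ((x'^-1 * x)^-1) ^ x'^-1)%g.
  by rewrite /conjg invgM !invgK !mulgA mulgK.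
by apply: nsg_normal; apply: subgroupV => //; exact: nsg_subgroup.
Qed.

Fact quotient_mulA : associative quotient_mul.
Proof.
move=> a b c; rewrite -(coset_ofK a) -(coset_ofK b) -(coset_ofK c).
by rewrite !quotient_mulE mulgA.
Qed.
Fact quotient_mul1g : left_id (coset_of 1%g) quotient_mul.
Proof. by move=> a; rewrite -(coset_ofK a) quotient_mulE mul1g. Qed.
Fact quotient_mulg1 : right_id (coset_of 1%g) quotient_mul.
Proof. by move=> a; rewrite -(coset_ofK a) quotient_mulE mulg1. Qed.
Fact quotient_mulVg : left_inverse (coset_of 1%g) quotient_inv quotient_mul.
Proof. by move=> a; rewrite -(coset_ofK a) quotient_invE quotient_mulE mulVg. Qed.
Fact quotient_mulgV : right_inverse (coset_of 1%g) quotient_inv quotient_mul.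
Proof. by move=> a; rewrite -(coset_ofK a) quotient_invE quotient_mulE mulgV. Qed.

HB.instance Definition _ := isGroup.Build quotient quotient_mulA
  quotient_mul1g quotient_mulg1 quotient_mulVg quotient_mulgV.

End Quotient.

HB.mixin Record isTopologicalGroup G & Topological G & Group G := {
  mulg_continuous : continuous (fun x : G * G => (x.1 * x.2)%g);
  invg_continuous : continuous (fun x : G => (x^-1)%g) }.

#[short(type="topGroupType")]
HB.structure Definition TopGroup :=
  {G of Topological G & Group G & isTopologicalGroup G}.

Record topGroupIso (G H : topGroupType) := TopGroupIso {
  tgi_fun :> G -> H;
  tgi_inv : H -> G;
  tgi_morph : {morph tgi_fun : x y / (x * y)%g};
  tgi_funK : cancel tgi_fun tgi_inv;
  tgi_invK : cancel tgi_inv tgi_fun;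
  tgi_fun_continuous : continuous tgi_fun;
  tgi_inv_continuous : continuous tgi_inv }.

Section OpenSubgroup.

Record openSubgroup (G : topGroupType) := OpenSubgroup {
  osg_set :> set G;
  osg_subgroup : is_subgroup osg_set;
  osg_open : open osg_set }.

Variables (G : topGroupType) (U : openSubgroup G).

Definition osg_type : Type := set_type U.

HB.instance Definition _ := Topological.copy osg_type (set_type U).

Definition osg_incl (u : osg_type) : G := \val u.

Lemma osg_inclP (u : osg_type) : osg_set U (osg_incl u).
Proof. exact: (set_valP u). Qed.

Definition osg_mk x (Ux : osg_set U x) : osg_type := exist _ x (mem_set Ux).

Lemma osg_incl_inj : injective osg_incl.
Proof. by move=> u v; exact: val_inj. Qed.

Lemma osg_incl_cts : continuous osg_incl.
Proof. exact: initial_continuous. Qed.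

Let sU := osg_subgroup U.

Definition osg_one : osg_type := osg_mk sU.1.
Definition osg_mul (u v : osg_type) : osg_type :=
  osg_mk (subgroupM sU (osg_inclP u) (osg_inclP v)).
Definition osg_inv (u : osg_type) : osg_type :=
  osg_mk (subgroupV sU (osg_inclP u)).

Fact osg_mulA : associative osg_mul.
Proof. by move=> u v w; apply: osg_incl_inj; exact: mulgA. Qed.
Fact osg_mul1g : left_id osg_one osg_mul.
Proof. by move=> u; apply: osg_incl_inj; exact: mul1g. Qed.
Fact osg_mulg1 : right_id osg_one osg_mul.
Proof. by move=> u; apply: osg_incl_inj; exact: mulg1. Qed.
Fact osg_mulVg : left_inverse osg_one osg_inv osg_mul.
Proof. by move=> u; apply: osg_incl_inj; exact: mulVg. Qed.
Fact osg_mulgV : right_inverse osg_one osg_inv osg_mul.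
Proof. by move=> u; apply: osg_incl_inj; exact: mulgV. Qed.

HB.instance Definition _ :=
  isGroup.Build osg_type osg_mulA osg_mul1g osg_mulg1 osg_mulVg osg_mulgV.

Fact osg_mulg_continuous : continuous (fun u : osg_type * osg_type => (u.1 * u.2)%g).
Proof.
apply: continuous_comp_initial.
apply: (@comp_cts _ (G * G)%type _ (fun u => (osg_incl u.1, osg_incl u.2))
  (fun x => x.1 * x.2)%g); last exact: mulg_continuous.
apply: pair_cts.
  exact: (comp_cts (@fst_cts _ _) osg_incl_cts).
exact: (comp_cts (@snd_cts _ _) osg_incl_cts).
Qed.

Fact osg_invg_continuous : continuous (fun u : osg_type => (u^-1)%g).
Proof.
apply: continuous_comp_initial.
exact: (comp_cts osg_incl_cts (@invg_continuous G)).
Qed.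

HB.instance Definition _ :=
  isTopologicalGroup.Build osg_type osg_mulg_continuous osg_invg_continuous.

End OpenSubgroup.

Section ImageOpenSubgroup.
Variables (G H : topGroupType) (Phi : topGroupIso G H) (U : openSubgroup G).

Lemma tgi1 : Phi 1%g = 1%g.
Proof. by apply: (mulgI (Phi 1%g)); rewrite -tgi_morph !mulg1. Qed.

Lemma tgiV x : Phi (x^-1)%g = (Phi x)^-1%g.
Proof. by apply: (mulgI (Phi x)); rewrite -tgi_morph !mulgV tgi1. Qed.

Lemma image_osg_subgroup : is_subgroup (Phi @` U).
Proof.
split; first by exists 1%g; [exact: (osg_subgroup U).1|exact: tgi1].
move=> _ _ [x Ux <-] [y Uy <-]; exists (x / y)%g.
  exact: (osg_subgroup U).2.
by rewrite tgi_morph tgiV.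
Qed.

Lemma image_osg_open : open (Phi @` U).
Proof.
have -> : Phi @` U = tgi_inv Phi @^-1` U.
  apply/seteqP; split=> [_ [x Ux <-]|y Uy] /=; first by rewrite tgi_funK.
  by exists (tgi_inv Phi y) => //; rewrite tgi_invK.
apply: open_comp; last exact: osg_open.
by move=> y _; exact: tgi_inv_continuous.
Qed.

Definition image_osg : openSubgroup H :=
  OpenSubgroup image_osg_subgroup image_osg_open.

End ImageOpenSubgroup.

Section TopologicalQuotient.
Variables (G : topGroupType) (N : normalSubgroup G).

(* [quotient N] carries no topology; [top_quotient N] is the same group with
   the quotient topology of [G]. *)
Definition top_quotient : Type := quotient N.

HB.instance Definition _ := Group.copy top_quotient (quotient N).
Definition top_coset (x : G) : top_quotient := coset_of N x.

Lemma top_cosetM x y : (top_coset x * top_coset y = top_coset (x * y))%g.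
Proof. exact: quotient_mulE. Qed.

Lemma top_cosetK (a : top_quotient) : top_coset (repr (a : quotient N)) = a.
Proof. exact: coset_ofK. Qed.

Definition top_quotient_open (W : set top_quotient) := open (top_coset @^-1` W).

Fact top_quotient_openT : top_quotient_open setT.
Proof. by rewrite /top_quotient_open preimage_setT; exact: openT. Qed.
Fact top_quotient_openI : setI_closed top_quotient_open.
Proof. by move=> V W oV oW; exact: openI. Qed.
Fact top_quotient_open_bigU (I : Type) (f : I -> set top_quotient) :
  (forall i, top_quotient_open (f i)) -> top_quotient_open (\bigcup_i f i).
Proof. by move=> of_; apply: bigcup_open => i _; exact: of_. Qed.

HB.instance Definition _ := isOpenTopological.Build top_quotient
  top_quotient_openT top_quotient_openI top_quotient_open_bigU.

Lemma top_coset_cts : continuous top_coset.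
Proof. exact/continuousP. Qed.

Lemma top_quotient_openE (W : set (top_quotient)) : open W = open (top_coset @^-1` W).
Proof. by []. Qed.

Lemma top_coset_open (A : set G) : open A -> open (top_coset @` A).
Proof.
move=> oA; rewrite top_quotient_openE.
have -> : top_coset @^-1` (top_coset @` A) =
    \bigcup_(n in nsg_set N) [set x | A (x * n)%g].
  apply/seteqP; split=> [x [a Aa /esym/coset_ofP Nax]|x [n Nn /= Axn]].
    by exists (x^-1 * a)%g => //=; rewrite mulgA mulgV mul1g.
  exists (x * n)%g => //; apply/coset_ofP.
  rewrite invgM -mulgA mulVg mulg1.
  exact: subgroupV (nsg_subgroup N) Nn.
apply: bigcup_open => n Nn.
apply: (@open_comp _ _ (fun x : G => x * n)%g) => // x _.
have /= cM := @comp_cts _ _ _ (fun y : G => (y, n)) _ _ (@mulg_continuous G).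
apply: cM; apply: pair_cts; first by move=> y; exact: cvg_id.
by move=> y; exact: cvg_cst.
Qed.

Fact top_quotient_mulg_continuous :
  continuous (fun a : top_quotient * top_quotient => (a.1 * a.2)%g).
Proof.
move=> [a b]; rewrite -(top_cosetK a) -(top_cosetK b).
set x := repr (a : quotient N); set y := repr (b : quotient N) => W /=.
have -> : (top_coset x * top_coset y = top_coset (x * y))%g.
  exact: top_cosetM.
move=> /(top_coset_cts) nW.
have [[A B] /= [nA nB] AB] := @mulg_continuous G (x, y) _ nW.
exists (top_coset @` A°, top_coset @` B°) => /=.
  split; apply: open_nbhs_nbhs; split.
  - exact/top_coset_open/open_interior.
  - by exists x => //; exact: nA.
  - exact/top_coset_open/open_interior.
  - by exists y => //; exact: nB.
move=> [_ _] /= [[u /interior_subset Au <-] [v /interior_subset Bv <-]].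
have -> : (top_coset u * top_coset v = top_coset (u * v))%g.
  exact: top_cosetM.
exact: (AB (u, v)).
Qed.

Fact top_quotient_invg_continuous : continuous (fun a : top_quotient => (a^-1)%g).
Proof.
apply/continuousP => W oW; rewrite top_quotient_openE.
have -> : top_coset @^-1` ((fun a : top_quotient => (a^-1)%g) @^-1` W) =
    (fun x : G => x^-1)%g @^-1` (top_coset @^-1` W).
  by apply/funext => x /=; congr W; exact: quotient_invE.
by apply: open_comp => // x _; exact: invg_continuous.
Qed.

HB.instance Definition _ := isTopologicalGroup.Build (top_quotient)
  top_quotient_mulg_continuous top_quotient_invg_continuous.

End TopologicalQuotient.

Section ClosedNormalClosure.
Variables (G : topGroupType) (A : set G).

(* The smallest closed normal subgroup of [G] containing [A]. *)
Definition closed_normal_closure : set G :=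
  [set g | forall N : set G, is_subgroup N -> is_normal N -> closed N ->
     A `<=` N -> N g].

Lemma closed_normal_closure_subgroup : is_subgroup closed_normal_closure.
Proof.
split=> [N sN _ _ _|x y Nx Ny N sN nN cN AN]; first exact: sN.1.
by apply: sN.2; [exact: Nx|exact: Ny].
Qed.

Lemma closed_normal_closure_normal : is_normal closed_normal_closure.
Proof. by move=> x g Nx N sN nN cN AN; apply: (nN x g); exact: Nx. Qed.

Lemma closed_normal_closure_closed : closed closed_normal_closure.
Proof.
move=> x cx N sN nN cN AN; have sub : closed_normal_closure `<=` N by move=> y Ny; exact: Ny.
by apply: cN; exact: closure_subset sub _ cx.
Qed.

Lemma sub_closed_normal_closure : A `<=` closed_normal_closure.
Proof. by move=> x Ax N _ _ _; exact. Qed.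

Definition closed_normal_closure_nsg : normalSubgroup G :=
  NormalSubgroup closed_normal_closure_subgroup closed_normal_closure_normal.

End ClosedNormalClosure.

Section ProfiniteCompletion.
Variable G : groupType.

(* The profinite completion is the inverse limit of the quotients [G / N] over
   the normal subgroups [N] of finite index, with the topology induced from the
   product of the discrete spaces [G / N].  For [N `<=` N'] the transition map
   sends [g N] to [g N']. *)
Record finiteIndexNormal := FiniteIndexNormal {
  fin_nsg :> normalSubgroup G;
  fin_index : finite_set [set: quotient fin_nsg] }.

HB.instance Definition _ := gen_eqMixin finiteIndexNormal.

Local Notation product :=
  (prod_topology (fun N : finiteIndexNormal => discrete_topology (quotient N))).

Definition compatible : set product :=
  [set a | forall (N N' : finiteIndexNormal) (g : G), nsg_set N `<=` nsg_set N' ->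
     a N = coset_of N g -> a N' = coset_of N' g].

Definition profinite_completion : Type := set_type compatible.

HB.instance Definition _ :=
  Topological.copy profinite_completion (set_type compatible).

Definition component (a : profinite_completion) (N : finiteIndexNormal) :
  quotient N := (\val a : product) N.

Lemma component_inj a b : (forall N, component a N = component b N) -> a = b.
Proof. by move=> ab; apply: val_inj; apply: functional_extensionality_dep. Qed.

Lemma componentP a (N N' : finiteIndexNormal) g :
  nsg_set N `<=` nsg_set N' ->
  component a N = coset_of N g -> component a N' = coset_of N' g.
Proof. exact: (set_valP a). Qed.

Definition profinite_mk (a : forall N : finiteIndexNormal, quotient N)
    (ca : compatible a) : profinite_completion :=
  exist _ (a : product) (mem_set ca).

Fact profinite_mul_compatible a b :
  compatible (fun N => component a N * component b N)%g.
Proof.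
move=> N N' g NN' ab.
have [x aN] : exists x, component a N = coset_of N x.
  by exists (repr (component a N)); rewrite coset_ofK.
have [y bN] : exists y, component b N = coset_of N y.
  by exists (repr (component b N)); rewrite coset_ofK.
move: ab; rewrite aN bN [LHS]quotient_mulE => /coset_ofP xyg.
rewrite (componentP NN' aN) (componentP NN' bN) [LHS]quotient_mulE.
exact/coset_ofP/NN'.
Qed.

Fact profinite_inv_compatible a : compatible (fun N => (component a N)^-1)%g.
Proof.
move=> N N' g NN' ab.
have [x aN] : exists x, component a N = coset_of N x.
  by exists (repr (component a N)); rewrite coset_ofK.
move: ab; rewrite aN [LHS]quotient_invE => /coset_ofP xg.
rewrite (componentP NN' aN) [LHS]quotient_invE.
exact/coset_ofP/NN'.
Qed.

Fact profinite_iota_compatible (x : G) : compatible (fun N => coset_of N x).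
Proof. by move=> N N' g NN' /coset_ofP /NN' xg; exact/coset_ofP. Qed.

Definition profinite_iota (x : G) : profinite_completion :=
  profinite_mk (@profinite_iota_compatible x).
Definition profinite_mul a b : profinite_completion :=
  profinite_mk (@profinite_mul_compatible a b).
Definition profinite_inv a : profinite_completion :=
  profinite_mk (@profinite_inv_compatible a).

Fact profinite_mulA : associative profinite_mul.
Proof. by move=> a b c; apply: component_inj => N; exact: mulgA. Qed.
Fact profinite_mul1g : left_id (profinite_iota 1%g) profinite_mul.
Proof. by move=> a; apply: component_inj => N; exact: mul1g. Qed.
Fact profinite_mulg1 : right_id (profinite_iota 1%g) profinite_mul.
Proof. by move=> a; apply: component_inj => N; exact: mulg1. Qed.
Fact profinite_mulVg :
  left_inverse (profinite_iota 1%g) profinite_inv profinite_mul.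
Proof. by move=> a; apply: component_inj => N; exact: mulVg. Qed.
Fact profinite_mulgV :
  right_inverse (profinite_iota 1%g) profinite_inv profinite_mul.
Proof. by move=> a; apply: component_inj => N; exact: mulgV. Qed.

HB.instance Definition _ := isGroup.Build profinite_completion profinite_mulA
  profinite_mul1g profinite_mulg1 profinite_mulVg profinite_mulgV.

Lemma component_cts (N : finiteIndexNormal) : continuous
  (fun a : profinite_completion => component a N : discrete_topology (quotient N)).
Proof.
apply: (@comp_cts profinite_completion product (discrete_topology (quotient N))
  (fun a => \val a) (fun f => f N)).
  exact: initial_continuous.
exact: (@proj_continuous finiteIndexNormal
  (fun N => discrete_topology (quotient N)) N).
Qed.

Lemma profinite_cts (S : topologicalType) (f : S -> profinite_completion) :
  (forall N : finiteIndexNormal,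
     continuous (fun s => component (f s) N : discrete_topology (quotient N))) ->
  continuous f.
Proof.
move=> cf; apply: continuous_comp_initial => s.
apply/cvg_sup => N; exact: (@continuous_comp_initial _ _ _ _ _ (cf N) s).
Qed.

Lemma discrete_cts (A : discreteTopologicalType) (B : topologicalType) (f : A -> B) :
  continuous f.
Proof. by apply/continuousP => W _; exact: discrete_open. Qed.

Lemma discrete_cts2 (A B : discreteTopologicalType) (C : topologicalType)
  (f : A * B -> C) : continuous f.
Proof.
move=> [a b] W /nbhs_singleton Wab; exists ([set a], [set b]) => /=.
  by split; exact: discrete_set1.
by move=> [_ _] /= [-> ->].
Qed.

Fact profinite_mulg_continuous : continuous
  (fun a : profinite_completion * profinite_completion => (a.1 * a.2)%g).
Proof.
apply: profinite_cts => N.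
pose D := discrete_topology (quotient N).
apply: (@comp_cts _ (D * D)%type D (fun a => (component a.1 N, component a.2 N))
  (fun q => ((q.1 : quotient N) * (q.2 : quotient N))%g)); last exact: discrete_cts2.
apply: pair_cts.
  exact: (@comp_cts _ profinite_completion D (fun a => a.1)
    (fun a => component a N) (@fst_cts _ _) (@component_cts N)).
exact: (@comp_cts _ profinite_completion D (fun a => a.2)
    (fun a => component a N) (@snd_cts _ _) (@component_cts N)).
Qed.

Fact profinite_invg_continuous :
  continuous (fun a : profinite_completion => (a^-1)%g).
Proof.
apply: profinite_cts => N.
pose D := discrete_topology (quotient N).
apply: (@comp_cts _ D D (fun a => component a N)
  (fun q => ((q : quotient N)^-1)%g)); last exact: discrete_cts.
exact: component_cts.
Qed.

HB.instance Definition _ := isTopologicalGroup.Build profinite_completion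
  profinite_mulg_continuous profinite_invg_continuous.

Lemma profinite_iotaM : {morph profinite_iota : x y / (x * y)%g}.
Proof.
by move=> x y; apply: component_inj => N; apply/esym; exact: quotient_mulE.
Qed.

End ProfiniteCompletion.

Arguments profinite_iota {G} x.

(* [inertia m U x] is a subset of the profinite completion, while the subgroup
   [ramification m U] is formed inside the topological group [osg_type U],
   so normal and closed are relative to [U]. *)
Section Ramification.
Variables (G : groupType) (m : G).
Local Notation Ghat := (profinite_completion G).

Definition meridian_closure : set Ghat :=
  closure (profinite_iota @` cyclic_subgroup m).

Variable U : openSubgroup Ghat.

Definition inertia (x : Ghat) : set Ghat := U `&` conj_set meridian_closure x.

Definition ramification : normalSubgroup (osg_type U) :=
  closed_normal_closure_nsg (\bigcup_x (@osg_incl Ghat U @^-1` inertia x)).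

End Ramification.

Section Knots.
Variable R : realType.

Definition sqn n (v : 'rV[R]_n) : R := \sum_i v 0 i ^+ 2.

Definition S3 : Type := set_type [set v : 'rV[R]_4 | sqn v = 1].

HB.instance Definition _ :=
  Topological.copy S3 (set_type [set v : 'rV[R]_4 | sqn v = 1]).

Definition S3_coord (x : S3) : 'rV[R]_4 := \val x.

Definition circle : set 'rV[R]_2 := [set v | sqn v = 1].
Definition disk (r : R) : set 'rV[R]_2 := [set v | sqn v <= r ^+ 2].

Definition homeomorphism (f : S3 -> S3) : Prop :=
  continuous f /\ exists g : S3 -> S3, [/\ continuous g, cancel f g & cancel g f].

(* Only used for compact [A]; since [S3] is Hausdorff, such a map is then a
   homeomorphism of [A] onto its image. *)
Definition embeds_on (T : topologicalType) (A : set T) (f : T -> S3) : Prop :=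
  {within A, continuous f} /\ {in A &, injective f}.

(* Inverse stereographic projection from the pole (0, 0, 0, 1). *)
Definition stereo (u : 'rV[R]_3) : 'rV[R]_4 :=
  (sqn u + 1)^-1 *: (row_mx (2 *: u) (sqn u - 1)%:M : 'rV[R]_(3 + 1)).

Definition edge (v : nat -> 'rV[R]_3) (i : nat) (s : R) : 'rV[R]_3 :=
  (1 - s) *: v i + s *: v i.+1.

(* The edges are half-open, so injectivity says that the closed polygon with
   vertices v 0, ..., v n = v 0 has no self-intersection. *)
Definition simple_closed_polygon (P : set 'rV[R]_3) : Prop :=
  exists (n : nat) (v : nat -> 'rV[R]_3),
    [/\ (0 < n)%N, v n = v 0%N,
        forall i j s t, (i < n)%N -> (j < n)%N -> 0 <= s < 1 -> 0 <= t < 1 ->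
          edge v i s = edge v j t -> i = j /\ s = t &
        P = [set p | exists i s, [/\ (i < n)%N, 0 <= s < 1 & p = edge v i s]]].

(* A knot is tame when a homeomorphism of the 3-sphere carries it to a polygon
   of R^3. *)
Definition tame_knot (K : set S3) : Prop :=
  exists (f : S3 -> S3) (P : set 'rV[R]_3),
    [/\ homeomorphism f, simple_closed_polygon P &
        S3_coord @` (f @` K) = stereo @` P].

(* The set on the right is the great circle where the last two coordinates
   vanish.  Homeomorphisms reversing the orientation are allowed; this circle is
   invariant under reflections of the sphere, so this makes no difference. *)
Definition trivial_knot (K : set S3) : Prop :=
  exists f : S3 -> S3, homeomorphism f /\
    f @` K = [set x | rsubmx (S3_coord x : 'rV[R]_(2 + 2)) = 0].

(* [V] is a closed solid torus with core [K].  The parametrization is required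
   to extend to the solid torus of radius 2: this collar rules out embeddings
   of the solid torus whose boundary is wildly embedded in the sphere. *)
Definition tubular_neighbourhood (K V : set S3) : Prop :=
  exists h : 'rV[R]_2 * 'rV[R]_2 -> S3,
    [/\ embeds_on (circle `*` disk 2) h,
        h @` (circle `*` [set 0]) = K &
        h @` (circle `*` disk 1) = V].

(* By invariance of domain the topological interior of [V] is the image of the
   open solid torus, and [V `\` V°] is the boundary of the exterior. *)
Definition exterior (V : set S3) : Type := set_type (~` V°).
Definition boundary_torus (V : set S3) : Type := set_type (V `\` V°).

HB.instance Definition _ (V : set S3) :=
  Topological.copy (exterior V) (set_type (~` V°)).
HB.instance Definition _ (V : set S3) :=
  Topological.copy (boundary_torus V) (set_type (V `\` V°)).

Section Meridian.
Variables K V : set S3.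

Lemma boundary_incl_subproof (x : boundary_torus V) : \val x \in ~` V°.
Proof. by apply: mem_set; have [] := set_valP x. Qed.

Definition boundary_incl (x : boundary_torus V) : exterior V :=
  exist _ (\val x) (boundary_incl_subproof x).

Lemma boundary_incl_continuous : continuous boundary_incl.
Proof. by apply: continuous_comp_initial; exact: initial_continuous. Qed.

HB.instance Definition _ :=
  isContinuous.Build _ _ boundary_incl boundary_incl_continuous.

Definition knot_group (x0 : boundary_torus V) : Type := pi1 R (boundary_incl x0).

HB.instance Definition _ x0 :=
  Group.copy (knot_group x0) (pi1 R (boundary_incl x0)).

(* The disk [D] meets [K] transversally at [p]: there is a local chart around
   [p] in which [K] is the vertical axis and [D] the horizontal plane.  Without
   transversality an inessential curve of the torus could also bound a disk
   touching [K] in a single point. *)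
Definition cylinder : set ('rV[R]_2 * R) := disk 1 `*` `[(-1 : R), 1]%classic.

Definition transverse_at (D : set S3) (p : S3) : Prop :=
  exists phi : 'rV[R]_2 * R -> S3,
    [/\ embeds_on cylinder phi, phi (0, 0) = p,
        forall z, cylinder z -> K (phi z) <-> z.1 = 0 &
        forall z, cylinder z -> D (phi z) <-> z.2 = 0].

(* A simple closed curve on the boundary torus bounding a disk [d] that is
   embedded in [V] and meets [K] once. *)
Definition meridian_curve (x0 : boundary_torus V)
    (gamma : {path (unit_interval R) from x0 to x0 in boundary_torus V}) : Prop :=
  (forall s t, s != one -> t != one -> gamma s = gamma t -> s = t) /\
  exists (d : 'rV[R]_2 -> S3) (p : S3),
    [/\ embeds_on (disk 1) d,
        d @` disk 1 `<=` V,
        d @` circle = [set \val (gamma t) | t in setT],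
        K `&` d @` disk 1 = [set p] &
        transverse_at (d @` disk 1) p].

Definition meridian (x0 : boundary_torus V) (m : knot_group x0) : Prop :=
  exists gamma : {path (unit_interval R) from x0 to x0 in boundary_torus V},
    meridian_curve gamma /\ m = pi1_map boundary_incl (loop_class gamma).

End Meridian.
End Knots.

(* Main.v *)
Require Import Defs.
From HB Require Import structures.
From mathcomp Require Import all_boot all_order all_algebra generic_quotient.
From mathcomp Require Import all_classical all_reals all_analysis homotopy.

(** The ramification subgroup of [U] is defined from the topological group and
    from the conjugates of the closure of [<m>] alone, and [Phi] respects both
    up to the conjugation by [y].

    Transport of structure shows that [Phi] carries the inertia subgroup of [U]
    at [x] to the inertia subgroup of [U'] at [Phi x * y]
    ([image_inertia]).  The factor [y] is absorbed because
    [x |-> Phi x * y] is a bijection of the completions, so [Phi] carries the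
    whole family of inertia subgroups of [U] onto that of [U']
    ([image_inertia_union]); this is why the definition has to range over all
    conjugates of the meridian, not only over those by elements of [U].
    The smallest closed normal subgroup containing a set depends only on the
    topological group structure, so the restriction of [Phi] to an isomorphism
    from [U] to [U'] matches the two ramification subgroups
    ([image_closed_normal_closure]), and therefore descends to the quotients
    ([quotient_iso]). *)

Set Implicit Arguments.
Unset Strict Implicit.
Unset Printing Implicit Defensive.

Local Open Scope classical_set_scope.

Section TopGroupIso.
Variables (G H : topGroupType) (Phi : topGroupIso G H).

Lemma tgi_inv_morph : {morph tgi_inv Phi : x y / (x * y)%g}.
Proof.
by move=> x y; apply: (can_inj (tgi_funK Phi)); rewrite tgi_morph !tgi_invK.
Qed.

Definition tgi_sym : topGroupIso H G :=
  TopGroupIso tgi_inv_morph (tgi_invK Phi) (tgi_funK Phi)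
    (@tgi_inv_continuous _ _ Phi) (@tgi_fun_continuous _ _ Phi).

Lemma image_conj_set (A : set G) (x : G) :
  Phi @` conj_set A x = conj_set (Phi @` A) (Phi x).
Proof.
rewrite /conj_set !image_comp.
by apply: eq_imagel => a _ /=; rewrite !tgi_morph tgiV.
Qed.

(** Preimages under [Phi] of closed normal subgroups are closed normal
    subgroups, so minimality can be used on both sides. *)
Lemma closed_normal_closure_preimage (A : set G) (B : set H) :
  A `<=` Phi @^-1` B ->
  closed_normal_closure A `<=` Phi @^-1` closed_normal_closure B.
Proof.
move=> AB g Ag N sN nN cN BN; apply: (Ag (Phi @^-1` N)).
- split=> [|x z Nx Nz] /=; first by rewrite tgi1; exact: sN.1.
  by rewrite tgi_morph tgiV; exact: sN.2.
- by move=> x z Nx; rewrite /= /conjg !tgi_morph tgiV; exact: nN.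
- by apply: closed_comp => // x _; exact: tgi_fun_continuous.
- by move=> x /AB /BN.
Qed.

End TopGroupIso.

Lemma image_closed_normal_closure (G H : topGroupType) (Phi : topGroupIso G H)
    (A : set G) :
  Phi @` closed_normal_closure A = closed_normal_closure (Phi @` A).
Proof.
apply/seteqP; split=> [_ [g Ag <-]|h Ah].
  apply: closed_normal_closure_preimage Ag => a Aa.
  by exists a.
exists (tgi_inv Phi h); last exact: tgi_invK.
apply: (@closed_normal_closure_preimage _ _ (tgi_sym Phi)) Ah.
by move=> _ [a Aa <-] /=; rewrite tgi_funK.
Qed.

Lemma conj_setM (G : groupType) (A : set G) (x y : G) :
  conj_set (conj_set A y) x = conj_set A (x * y)%g.
Proof.
rewrite /conj_set image_comp.
by apply: eq_imagel => a _ /=; rewrite invgM !mulgA.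
Qed.

Section RestrictedIso.
Variables (G H : topGroupType) (Phi : topGroupIso G H) (U : openSubgroup G).
Local Notation U' := (image_osg Phi U).

Definition osg_iso_fun (u : osg_type U) : osg_type U' :=
  @osg_mk H U' (Phi (osg_incl u)) (imageP Phi (osg_inclP u)).

Lemma osg_iso_inv_subproof (u : osg_type U') :
  osg_set U (tgi_inv Phi (osg_incl u)).
Proof. by have [x Ux <-] := osg_inclP u; rewrite tgi_funK. Qed.

Definition osg_iso_inv (u : osg_type U') : osg_type U :=
  osg_mk (osg_iso_inv_subproof u).

Lemma osg_iso_morph : {morph osg_iso_fun : u v / (u * v)%g}.
Proof. by move=> u v; apply: osg_incl_inj; exact: tgi_morph. Qed.

Lemma osg_iso_funK : cancel osg_iso_fun osg_iso_inv.
Proof. by move=> u; apply: osg_incl_inj; exact: tgi_funK. Qed.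

Lemma osg_iso_invK : cancel osg_iso_inv osg_iso_fun.
Proof. by move=> u; apply: osg_incl_inj; exact: tgi_invK. Qed.

Lemma osg_iso_fun_continuous : continuous osg_iso_fun.
Proof.
apply: continuous_comp_initial.
exact: (comp_cts (@osg_incl_cts _ U) (@tgi_fun_continuous _ _ Phi)).
Qed.

Lemma osg_iso_inv_continuous : continuous osg_iso_inv.
Proof.
apply: continuous_comp_initial.
exact: (comp_cts (@osg_incl_cts _ U') (@tgi_inv_continuous _ _ Phi)).
Qed.

Definition osg_iso : topGroupIso (osg_type U) (osg_type U') :=
  TopGroupIso osg_iso_morph osg_iso_funK osg_iso_invK
    osg_iso_fun_continuous osg_iso_inv_continuous.

End RestrictedIso.

Section QuotientMap.
Variables (G H : topGroupType) (Phi : topGroupIso G H).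
Variables (N : normalSubgroup G) (M : normalSubgroup H).

Definition quotient_map (a : top_quotient N) : top_quotient M :=
  top_coset M (Phi (repr (a : quotient N))).

Hypothesis NM : nsg_set N `<=` Phi @^-1` nsg_set M.

Lemma quotient_mapE x : quotient_map (top_coset N x) = top_coset M (Phi x).
Proof.
apply/coset_ofP; rewrite -tgiV -tgi_morph; apply: NM; apply/coset_ofP.
exact: coset_ofK.
Qed.

Lemma quotient_map_morph : {morph quotient_map : a b / (a * b)%g}.
Proof.
move=> a b; rewrite -(top_cosetK a) -(top_cosetK b).
by rewrite top_cosetM !quotient_mapE top_cosetM tgi_morph.
Qed.

Lemma quotient_map_continuous : continuous quotient_map.
Proof.
apply/continuousP => W oW; rewrite top_quotient_openE.
have -> : top_coset N @^-1` (quotient_map @^-1` W) =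
    Phi @^-1` (top_coset M @^-1` W).
  by apply/funext => x; rewrite /= quotient_mapE.
by apply: open_comp => // x _; exact: tgi_fun_continuous.
Qed.

End QuotientMap.

Section QuotientIso.
Variables (G H : topGroupType) (Phi : topGroupIso G H).
Variables (N : normalSubgroup G) (M : normalSubgroup H).
Hypothesis NM : Phi @` nsg_set N = nsg_set M.

Let subNM : nsg_set N `<=` Phi @^-1` nsg_set M.
Proof. by move=> x Nx; rewrite /preimage /= -NM; exists x. Qed.

Let subMN : nsg_set M `<=` tgi_sym Phi @^-1` nsg_set N.
Proof. by move=> y; rewrite -NM => -[x Nx <-] /=; rewrite tgi_funK. Qed.

Lemma quotient_map_funK : cancel (quotient_map Phi M) (quotient_map (tgi_sym Phi) N).
Proof.
by move=> a; rewrite -(top_cosetK a) (quotient_mapE subNM) (quotient_mapE subMN)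
  /= tgi_funK.
Qed.

Lemma quotient_map_invK : cancel (quotient_map (tgi_sym Phi) N) (quotient_map Phi M).
Proof.
by move=> a; rewrite -(top_cosetK a) (quotient_mapE subMN) (quotient_mapE subNM)
  /= tgi_invK.
Qed.

Definition quotient_iso : topGroupIso (top_quotient N) (top_quotient M) :=
  TopGroupIso (quotient_map_morph subNM) quotient_map_funK quotient_map_invK
    (quotient_map_continuous subNM) (quotient_map_continuous subMN).

Lemma quotient_isoE x : quotient_iso (top_coset N x) = top_coset M (Phi x).
Proof. exact: quotient_mapE. Qed.

End QuotientIso.

Section Ramification.
Variables (G G' : groupType) (m : G) (m' : G').
Variables (Phi : topGroupIso (profinite_completion G) (profinite_completion G')).
Variable y : profinite_completion G'.
Hypothesis Phi_m : Phi @` meridian_closure m = conj_set (meridian_closure m') y.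
Variable U : openSubgroup (profinite_completion G).
Local Notation U' := (image_osg Phi U).

Lemma image_inertia x : Phi @` inertia m U x = inertia m' U' (Phi x * y)%g.
Proof.
rewrite /inertia -conj_setM -Phi_m -image_conj_set.
apply/seteqP; split=> [_ [z [Uz Iz] <-]|_ [[z Uz <-] [w Iw wz]]].
  by split; exists z.
by exists z => //; split=> //; rewrite -(can_inj (tgi_funK Phi) wz).
Qed.

Lemma image_inertia_union :
  osg_iso Phi U @` (\bigcup_x (@osg_incl _ U @^-1` inertia m U x)) =
  \bigcup_x (@osg_incl _ U' @^-1` inertia m' U' x).
Proof.
apply/seteqP; split=> [_ [u [x _ Iu] <-]|u' [x' _ Iu']].
  by exists (Phi x * y)%g => //=; rewrite -image_inertia; exists (osg_incl u).
pose x := tgi_inv Phi (x' * y^-1)%g.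
have x'E : x' = (Phi x * y)%g by rewrite tgi_invK mulgVK.
move: Iu'; rewrite /= x'E -image_inertia => -[z Iz zu'].
exists (osg_mk Iz.1); first by exists x.
exact: osg_incl_inj.
Qed.

Lemma image_ramification :
  osg_iso Phi U @` ramification m U = ramification m' U'.
Proof.
rewrite /ramification -image_inertia_union.
exact: image_closed_normal_closure.
Qed.

End Ramification.

Theorem corollary5p3 (R : realType)
    (K V K' V' : set (S3 R))
    (tameK : tame_knot K) (nuK : tubular_neighbourhood K V)
    (tameK' : tame_knot K') (nuK' : tubular_neighbourhood K' V')
    (nontrivialK : ~ trivial_knot K)
    (x0 : boundary_torus V) (x0' : boundary_torus V')
    (m : knot_group x0) (m' : knot_group x0')
    (meridian_m : meridian K m) (meridian_m' : meridian K' m')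
    (Phi : topGroupIso (profinite_completion (knot_group x0))
                       (profinite_completion (knot_group x0')))
    (y : profinite_completion (knot_group x0'))
    (Phi_meridian : Phi @` meridian_closure m = conj_set (meridian_closure m') y)
    (U : openSubgroup (profinite_completion (knot_group x0))) :
  let U' := image_osg Phi U in
  Phi @` (@osg_incl _ U @` ramification m U) =
    @osg_incl _ U' @` ramification m' U' /\
  exists Psi : topGroupIso (top_quotient (ramification m U))
                           (top_quotient (ramification m' U')),
    forall (u : osg_type U) (u' : osg_type U'),
      osg_incl u' = Phi (osg_incl u) ->
      Psi (top_coset (ramification m U) u) = top_coset (ramification m' U') u'.
Proof.
move=> U'.
have imF := image_ramification Phi_meridian U.
split.
  by rewrite -imF !image_comp.
exists (quotient_iso imF) => u u' uu'.
rewrite quotient_isoE; congr top_coset.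
by apply: osg_incl_inj; rewrite uu'.
Qed.
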